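(* Let $d\ge 2$ and $n\ge 2$ be integers. Let $U'_{d;n}$ be the matrix output by the greedy algorithm described in the context, and let $U_{d;n}$ be the matrix obtained from $U'_{d;n}$ by removing its last $n-1$ columns and taking the reduced form of the resulting matrix. Then $U_{d;n}$ is a u-cycle for $d$-dimensional $n$-permutations.
   Context: **$d$-dimensional permutations.** A $d$-dimensional $n$-permutation is an ordered $(d-1)$-tuple $(\pi^2,\dots,\pi^d)$ of permutations of $\{1,\dots,n\}$. It is identified with the $(d-1)\times n$ matrix whose rows are $\pi^2,\dots,\pi^d$ in one-line notation (the additional top row $12\cdots n$ is omitted). There are $(n!)^{d-1}$ of them. **Reduced form.** For a finite sequence of distinct integers, its reduced form is obtained by replacing the $i$-th smallest entry by $i$, for each $i$. For a matrix $M$ in which each row has distinct entries, $\mathrm{red}(M)$ is obtained by replacing each row by its reduced form. **U-cycle.** A matrix with $d-1$ rows is a u-cycle for $d$-dimensional $n$-permutations if each $d$-dimensional $n$-permutation occurs in it exactly once as the reduced form of $n$ consecutive columns, where consecutive columns are considered cyclically (the first column follows the last). **Extensions.** Let $\Pi=\Pi_1\cdots\Pi_m$ be a matrix with $d-1$ rows and columns $\Pi_1,\dots,\Pi_m$, each row consisting of $m$ distinct integers. For $1\le i\le (m+1)^{d-1}$, let $(i_1,\dots,i_{d-1})^T$ be the $i$-th lexicographically smallest element of $\{1,\dots,m+1\}^{d-1}$. Let $B=(b_1,\dots,b_{d-1})^T$, where $b_j$ is the $i_j$-th smallest entry of row $j$ of $\Pi$ if $i_j\le m$, and $b_j$ is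 one more than the maximum entry of row $j$ of $\Pi$ if $i_j=m+1$. For any matrix $M$ with $d-1$ rows, $C_B(M)$ is obtained from $M$ by increasing by one every entry in row $j$ that is $\ge b_j$, for each $j$, and leaving all other entries unchanged. The $i$-th extension of $\Pi$ is the matrix $C_B(\Pi)B$ ($C_B(\Pi)$ with the column $B$ appended on the right), and $B$ is its last element. **Greedy algorithm.** $I_{d;m}$ denotes the matrix with $d-1$ rows, each equal to $12\cdots m$. Begin with $U'_{d;n,0}:=I_{d;n-1}$. Suppose $U'_{d;n,k}=\Pi_1\Pi_2\cdots\Pi_{k+n-1}$ (a matrix with $d-1$ rows and columns $\Pi_i$) has been constructed and no two distinct windows of $n$ consecutive columns in it have the same reduced form. Let $i$ be minimal such that no $n$ consecutive columns in $U'_{d;n,k}$ have the same reduced form as the $i$-th extension of $\Pi_{k+1}\Pi_{k+2}\cdots\Pi_{k+n-1}$, and let $B$ be the last element of this extension. Then set $U'_{d;n,k+1}:=C_B(\Pi_1\Pi_2\cdots\Pi_{k+n-1})B$. If for some $k=k^*$ no such $i$ exists, the algorithm terminates and outputs $U'_{d;n}:=U'_{d;n,k^*}$. All windows used here are non-cyclic. *)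

(* Defs.v *)
From mathcomp Require Import all_boot all_order all_fingroup.

Set Implicit Arguments.
Unset Strict Implicit.
Unset Printing Implicit Defensive.

(* A matrix with d - 1 rows is the sequence of its columns: the algorithm keeps
   changing the number of columns.  All entries that occur are positive. *)
Definition column (d : nat) := {ffun 'I_d.-1 -> nat}.
Definition mat (d : nat) := seq (column d).

Definition mrow d (M : mat d) (j : 'I_d.-1) : seq nat :=
  [seq c j | c : column d <- M].

(* The k-th smallest element of s, for 1 <= k <= size s. *)
Definition kth_smallest (s : seq nat) (k : nat) : nat := nth 0 (sort leq s) k.-1.

(* The k such that x is the k-th smallest element of s. *)
Definition rank_in (s : seq nat) (x : nat) : nat := (index x (sort leq s)).+1.

Definition reduced d (M : mat d) : mat d :=
  [seq [ffun j => rank_in (mrow M j) (c j)] | c : column d <- M].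

Definition dperm (d n : nat) := d.-1.-tuple 'S_n.

(* 'S_n permutes {0, ..., n-1}, hence the shift by one. *)
Definition dperm_matrix d n (p : dperm d n) : mat d :=
  [seq [ffun j => (tnth p j i).+1] | i <- enum 'I_n].

Definition cyclic_window d (n : nat) (M : mat d) (k : nat) : mat d :=
  mkseq (fun l => nth [ffun=> 0] M ((k + l) %% size M)) n.

Definition is_ucycle (d n : nat) (M : mat d) : Prop :=
  forall p : dperm d n,
    exists! k : 'I_(size M), reduced (cyclic_window n M k) = dperm_matrix p.

(* {1, ..., m+1}^(d-1) in increasing lexicographic order, every coordinate
   being shifted down by one. *)
Definition lex_indices (d m : nat) : seq (d.-1.-tuplelexi 'I_m.+1) :=
  sort <=%O (enum {: d.-1.-tuplelexi 'I_m.+1}).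

(* The j-th coordinate of the i-th element of {1, ..., m+1}^(d-1), for
   1 <= i <= (m+1)^(d-1). *)
Definition lex_coord d (m i : nat) (j : 'I_d.-1) : nat :=
  (tnth (nth (nseq_tuple d.-1 ord0) (lex_indices d m) i.-1) j).+1.

(* The last element B of the i-th extension of M. *)
Definition ext_last d (M : mat d) (i : nat) : column d :=
  [ffun j => let k := lex_coord (size M) i j in
             if k <= size M then kth_smallest (mrow M j) k
             else (\max_(x <- mrow M j) x).+1].

(* C_B(M) *)
Definition incr_ge d (B : column d) (M : mat d) : mat d :=
  [seq [ffun j => if B j <= c j then (c j).+1 else c j] | c : column d <- M].

(* C_B(M)B *)
Definition append_last d (M : mat d) (B : column d) : mat d :=
  rcons (incr_ge B M) B.

Definition extension d (M : mat d) (i : nat) : mat d :=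
  append_last M (ext_last M i).

(* The n consecutive columns of M, non-cyclically; there are none when
   size M < n. *)
Definition windows d (n : nat) (M : mat d) : seq (mat d) :=
  [seq take n (drop k M) | k <- iota 0 ((size M).+1 - n)].

Definition red_occurs d (n : nat) (W M : mat d) : bool :=
  has (fun V => reduced V == reduced W) (windows n M).

Definition last_columns d (m : nat) (M : mat d) : mat d :=
  drop (size M - m) M.

Definition drop_last_columns d (m : nat) (M : mat d) : mat d :=
  take (size M - m) M.

(* I_{d;m} *)
Definition id_matrix (d m : nat) : mat d :=
  [seq [ffun=> i] | i <- iota 1 m].

(* The head of the filtered list is the minimal i whose extension is new;
   None means that there is no such i. *)
Definition greedy_step d (n : nat) (M : mat d) : option (mat d) :=
  let P := last_columns n.-1 M in
  let new i := ~~ red_occurs n (extension P i) M in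
  omap (fun i => append_last M (ext_last P i))
    (ohead [seq i <- iota 1 ((size P).+1 ^ d.-1) | new i]).

(* U'_{d;n,k}, or None when the algorithm has terminated before step k. *)
Definition greedy_state (d n k : nat) : option (mat d) :=
  iter k (obind (@greedy_step d n)) (Some (id_matrix d n.-1)).

Definition greedy_output (d n : nat) (M : mat d) : Prop :=
  exists k, greedy_state d n k = Some M /\ greedy_step n M = None.

(* Main.v *)
Require Import Defs.
From mathcomp Require Import all_boot all_order all_fingroup zify.

Set Implicit Arguments.
Unset Strict Implicit.
Unset Printing Implicit Defensive.

Import Order.TTheory.

(** Write [m = n - 1].  Patterns of [n] columns are the edges of a directed
    graph whose vertices are patterns of [m] columns: an edge leads from the
    pattern of its first [m] columns to that of its last [m] columns.  The
    algorithm traces a trail in this graph from the increasing vertex, always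
    taking the first unused edge in a fixed order in which the last resort is
    the edge whose new column is maximal in every row.

    All edges are used.  Rotating a window cyclically shows that every vertex has
    as many incoming as outgoing edges ([succ_rotate]), so the trail can only
    stop at its start ([stuck_closed]), and then a vertex whose outgoing edges
    are all used has all its incoming edges used as well.  Since a last resort
    is used only after its competitors, exhaustion spreads backwards along edges
    of last resort ([level_exhausted]); [m] last resorts in a row lead from any
    vertex to the increasing one, which is exhausted ([all_patterns_used]).

    Let [T] be the number of edges.  The windows of the output are all
    patterns, once each, but the last [m] of them involve the [m] columns that
    are then removed, and it remains to see that closing up cyclically restores
    their patterns.  Two facts do this.  The [m] initial columns are increasing
    and stay above everything appended later, because the first [m] steps append
    minima and later columns are inserted next to columns below the initial ones
    ([greedy_inv_step]).  And the final [m] columns are increasing, each above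
    the [m] columns before it, because the last [m] edges are edges of last
    resort ([final_window_last_max]).  Hence the initial columns compare with the
    end of the matrix exactly as the removed ones did ([cyclic_window_block]). *)

(** * Counting smaller entries *)

(** The rank of an entry is the number of smaller entries plus one.  Unlike the
    position in the sorted list, this number is visibly determined by the
    outcomes of comparisons. *)
Lemma index_sort_count (s : seq nat) x : x \in s ->
  index x (sort leq s) = count (fun y => y < x) s.
Proof.
have sorted_s : sorted leq (sort leq s) by apply: sort_sorted; exact: leq_total.
rewrite -(seq.permP (permEl (perm_sort leq s))) -(mem_sort leq).
elim: (sort leq s) sorted_s => //= y t IH.
rewrite path_sortedE; last exact: leq_trans.
case/andP=> /allP y_le sorted_t; rewrite inE eq_sym.
have [eq_yx _|ne_yx /= x_t] := eqVneq y x.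
  rewrite eq_yx ltnn; apply/esym/eqP; rewrite add0n -leqn0 leqNgt -has_count.
  by apply/hasPn => z /y_le le_yz; rewrite -leqNgt -eq_yx.
by rewrite IH // ltn_neqAle ne_yx y_le.
Qed.

(** The entry [x] itself is counted below every larger bound but not below [x],
    which makes the comparison strict. *)
Lemma count_lt_mono (s : seq nat) x y : x \in s ->
  (count (fun z => z < x) s < count (fun z => z < y) s) = (x < y).
Proof.
move=> x_s; have [lt_xy|le_yx] := ltnP x y; last first.
  by rewrite ltnNge sub_count // => z /= lt_zy; exact: leq_trans le_yx.
elim: s x_s => //= z s IH; rewrite inE.
have le_s : count (fun z => z < x) s <= count (fun z => z < y) s.
  by apply: sub_count => u /= lt_ux; exact: ltn_trans lt_xy.
have [<- _|ne_xz /= /IH] := eqVneq x z; first by rewrite ltnn lt_xy; lia.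
by case: (ltnP z x) => [lt_zx|_]; lia.
Qed.

(** * Order patterns of matrices *)

Definition entry d (M : mat d) (i : nat) (j : 'I_d.-1) : nat :=
  nth [ffun=> 0] M i j.

Lemma mrowE d (M : mat d) j : mrow M j = mkseq (fun i => entry M i j) (size M).
Proof.
apply: (@eq_from_nth _ 0); rewrite ?size_map ?size_iota // => i lt_i.
by rewrite nth_mkseq // (nth_map [ffun=> 0]).
Qed.

Lemma mem_mrow d (M : mat d) j x :
  reflect (exists2 i, i < size M & x = entry M i j) (x \in mrow M j).
Proof.
rewrite mrowE; apply: (iffP mapP) => [[i]|[i lt_i ->]].
  by rewrite mem_iota => lt_i ->; exists i.
by exists i; rewrite // mem_iota.
Qed.

Lemma entry_mrow d (M : mat d) i j : i < size M -> entry M i j \in mrow M j.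
Proof. by move=> lt_i; apply/mem_mrow; exists i. Qed.

Lemma size_mrow d (M : mat d) j : size (mrow M j) = size M.
Proof. exact: size_map. Qed.

Lemma size_reduced d (M : mat d) : size (reduced M) = size M.
Proof. exact: size_map. Qed.

Lemma entry_reduced d (M : mat d) i j : i < size M ->
  entry (reduced M) i j =
    (count (fun y => y < entry M i j) (mrow M j)).+1.
Proof.
move=> lt_i; rewrite /entry /reduced (nth_map [ffun=> 0]) // ffunE /rank_in.
by rewrite index_sort_count // entry_mrow.
Qed.

Lemma matP d (M N : mat d) : size M = size N ->
  (forall i j, i < size M -> entry M i j = entry N i j) -> M = N.
Proof.
move=> eq_sz eqMN; apply: (@eq_from_nth _ [ffun=> 0]) => // i lt_i.
by apply/ffunP => j; exact: eqMN.
Qed.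

Definition same_order d (M N : mat d) : Prop :=
  size M = size N /\
  forall i i' j, i < size M -> i' < size M ->
    (entry M i j < entry M i' j) = (entry N i j < entry N i' j).

(** Equality of reduced forms is used throughout in this form: comparisons
    between entries are easy to follow through the insertions made by the
    algorithm, ranks are not. *)
Lemma reducedP d (M N : mat d) : reduced M = reduced N <-> same_order M N.
Proof.
split=> [eq_red|[eq_sz eq_lt]].
  have eq_sz : size M = size N by rewrite -(size_reduced M) eq_red size_reduced.
  split=> // i i' j lt_i lt_i'.
  have red_lt (K : mat d) : i < size K -> i' < size K ->
    (entry K i j < entry K i' j) =
      (entry (reduced K) i j < entry (reduced K) i' j).
    by move=> ltK ltK'; rewrite !entry_reduced // ltnS count_lt_mono ?entry_mrow.
  by rewrite (red_lt M) ?(red_lt N) -?eq_sz ?eq_red.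
apply: matP => [|i j]; rewrite !size_reduced // => lt_i.
rewrite !entry_reduced -?eq_sz // !mrowE -eq_sz !count_map; congr _.+1.
by apply: eq_in_count => i'; rewrite mem_iota => lt_i' /=; exact: eq_lt.
Qed.

Lemma same_order_sym d (M N : mat d) : same_order M N -> same_order N M.
Proof. by move/reducedP=> eqMN; apply/reducedP. Qed.

Lemma same_order_reduced d (M : mat d) : same_order (reduced M) M.
Proof.
split=> [|i i' j]; rewrite size_reduced // => lt_i lt_i'.
by rewrite !entry_reduced // ltnS count_lt_mono ?entry_mrow.
Qed.

Definition distinct_rows d (M : mat d) : Prop :=
  forall i i' j, i < size M -> i' < size M ->
    entry M i j = entry M i' j -> i = i'.

Lemma distinct_rows_uniq d (M : mat d) j : distinct_rows M -> uniq (mrow M j).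
Proof.
move=> dM; rewrite mrowE map_inj_in_uniq ?iota_uniq // => i i'.
by rewrite !mem_iota; exact: dM.
Qed.

Definition block d (a l : nat) (M : mat d) : mat d := take l (drop a M).

Lemma size_block d a l (M : mat d) : a + l <= size M -> size (block a l M) = l.
Proof. by move=> le_al; rewrite size_takel // size_drop; lia. Qed.

Lemma entry_block d a l (M : mat d) i j : i < l ->
  entry (block a l M) i j = entry M (a + i) j.
Proof. by move=> lt_i; rewrite /entry nth_take // nth_drop. Qed.

Lemma lt_size_block d a l (M : mat d) i :
  (i < size (block a l M)) = (i < l) && (a + i < size M).
Proof. by rewrite size_take size_drop; case: ifP; lia. Qed.

Lemma same_order_block d a l (M N : mat d) :
  same_order M N -> same_order (block a l M) (block a l N).
Proof.
move=> [eq_sz eq_lt]; split; first by rewrite !size_take !size_drop eq_sz.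
move=> i i' j; rewrite !lt_size_block => /andP[lt_i lt_ai] /andP[lt_i' lt_ai'].
by rewrite !entry_block // eq_lt.
Qed.

Lemma distinct_rows_block d a l (M : mat d) :
  distinct_rows M -> distinct_rows (block a l M).
Proof.
move=> dM i i' j; rewrite !lt_size_block => /andP[lt_i lt_ai] /andP[lt_i' lt_ai'].
by rewrite !entry_block // => /dM eq_ai; apply: (@addnI a); exact: eq_ai.
Qed.

Lemma block_block d a l k n (M : mat d) : a + l <= n ->
  block a l (block k n M) = block (k + a) l M.
Proof.
move=> le_al; have le_la : l + a <= n by rewrite addnC.
by rewrite /block take_drop take_takel // -take_drop drop_drop addnC.
Qed.

Lemma reduced_block_eq d a l (M N : mat d) : reduced M = reduced N ->
  reduced (block a l M) = reduced (block a l N).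
Proof. by move/reducedP=> eqMN; apply/reducedP; exact: same_order_block. Qed.

Definition increasing d (M : mat d) : Prop :=
  forall i i' j, i < i' < size M -> entry M i j < entry M i' j.

Lemma increasing_same_order d (M N : mat d) :
  same_order M N -> increasing M -> increasing N.
Proof.
move=> [eq_sz eq_lt] incM i i' j; rewrite -eq_sz => /andP[lt_ii' lt_i'].
by rewrite -eq_lt // ?incM ?lt_ii' //; exact: ltn_trans lt_i'.
Qed.

Lemma same_order_increasing d (M N : mat d) : size M = size N ->
  increasing M -> increasing N -> same_order M N.
Proof.
move=> eq_sz incM incN; split=> // i i' j lt_i lt_i'.
have [lt_ii'|lt_i'i|->] := ltngtP i i'; last by rewrite !ltnn.
  by rewrite incM ?incN // lt_ii' -?eq_sz.
have := incM i' i j; have := incN i' i j; rewrite -eq_sz lt_i'i lt_i.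
by move=> /(_ isT) ltN /(_ isT) ltM; rewrite !ltnNge (ltnW ltM) (ltnW ltN).
Qed.

Definition last_max d (W : mat d) : Prop :=
  forall i j, i.+1 < size W -> entry W i j < entry W (size W).-1 j.

Lemma last_max_same_order d (M N : mat d) :
  same_order M N -> last_max M -> last_max N.
Proof.
move=> [eq_sz eq_lt] lmM i j; rewrite -eq_sz => lt_i.
by rewrite -eq_lt ?lmM //; lia.
Qed.

Lemma increasing_last_max d (M : mat d) : increasing M -> last_max M.
Proof. by move=> incM i j lt_i; apply: incM; lia. Qed.

(** * Matrices of multidimensional permutations *)

Lemma size_dperm_matrix d n (p : dperm d n) : size (dperm_matrix p) = n.
Proof. by rewrite size_map size_enum_ord. Qed.

Lemma entry_dperm_matrix d n (p : dperm d n) (i : 'I_n) j :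
  entry (dperm_matrix p) i j = (tnth p j i).+1.
Proof.
by rewrite /entry (nth_map i) ?size_enum_ord // ffunE nth_ord_enum.
Qed.

Lemma dperm_matrix_inj d n : injective (@dperm_matrix d n).
Proof.
move=> p q eq_pq; apply: eq_from_tnth => j; apply/permP => i.
by apply/val_inj/succn_inj; rewrite -!entry_dperm_matrix eq_pq.
Qed.

Lemma distinct_rows_dperm d n (p : dperm d n) : distinct_rows (dperm_matrix p).
Proof.
move=> i i' j; rewrite !size_dperm_matrix => lt_i lt_i'.
rewrite (entry_dperm_matrix p (Ordinal lt_i)).
rewrite (entry_dperm_matrix p (Ordinal lt_i')) => -[/val_inj/perm_inj].
by case.
Qed.

Lemma count_lt_iota k n : k <= n -> count (fun x => x < k) (iota 0 n) = k.
Proof.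
move=> le_kn; rewrite -(subnKC le_kn) iotaD count_cat.
rewrite (_ : count _ _ = size (iota 0 k)); last first.
  by apply/eqP; rewrite -all_count; apply/allP => x; rewrite mem_iota.
rewrite size_iota (_ : count _ _ = 0) ?addn0 //; apply/eqP.
rewrite -leqn0 leqNgt -has_count; apply/hasPn => x; rewrite mem_iota; lia.
Qed.

Lemma reduced_dperm_matrix d n (p : dperm d n) :
  reduced (dperm_matrix p) = dperm_matrix p.
Proof.
apply: matP => [|i j]; rewrite !size_reduced // size_dperm_matrix => lt_i.
rewrite entry_reduced ?size_dperm_matrix //.
rewrite !(entry_dperm_matrix p (Ordinal lt_i)); congr _.+1.
have -> : mrow (dperm_matrix p) j = [seq (tnth p j i').+1 | i' <- enum 'I_n].
  by rewrite /mrow -map_comp; apply: eq_map => i' /=; rewrite ffunE.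
rewrite (map_comp succn) count_map -[RHS](@count_lt_iota _ n); last exact: ltnW.
rewrite (map_comp val) -val_enum_ord; apply/seq.permP/perm_map/uniq_perm.
- by rewrite map_inj_uniq ?enum_uniq //; exact: perm_inj.
- exact: enum_uniq.
move=> i'; rewrite mem_enum; apply/mapP.
by exists ((tnth p j)^-1%g i'); rewrite ?mem_enum ?permKV.
Qed.

(** This allows windows to be labelled by elements of a finite type, over which
    edges can be counted. *)
Lemma pattern_exists d n (W : mat d) : size W = n -> distinct_rows W ->
  exists p : dperm d n, reduced W = dperm_matrix p.
Proof.
move=> sz_W dW.
pose rk (j : 'I_d.-1) i := count (fun y => y < entry W i j) (mrow W j).
have rk_lt j (i : 'I_n) : rk j i < n.
  have W_i : entry W i j \in mrow W j by rewrite entry_mrow ?sz_W.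
  rewrite /rk -index_sort_count //.
  by rewrite -[ltnRHS]sz_W -(size_mrow W j) -(size_sort leq) index_mem mem_sort.
have rk_inj j : injective (fun i => Ordinal (rk_lt j i)).
  move=> i i' [eq_rk]; apply: ord_inj; apply: (dW _ _ j); rewrite ?sz_W ?ltn_ord //.
  have mono k k' := @count_lt_mono (mrow W j) (entry W k j) (entry W k' j).
  have := mono i i'; have := mono i' i.
  rewrite !entry_mrow ?sz_W // -/(rk j i) -/(rk j i') eq_rk ltnn.
  move=> /(_ isT) ge1 /(_ isT) ge2; apply/eqP.
  by rewrite eqn_leq leqNgt -ge1 leqNgt -ge2.
exists [tuple perm (@rk_inj j) | j < d.-1].
apply: matP => [|i j]; rewrite size_reduced ?size_dperm_matrix // sz_W => lt_i.
rewrite entry_reduced ?sz_W // (entry_dperm_matrix _ (Ordinal lt_i)).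
by rewrite tnth_mktuple permE.
Qed.

Definition window_pred d m (e : dperm d m.+1) : mat d :=
  reduced (block 0 m (dperm_matrix e)).

Definition window_succ d m (e : dperm d m.+1) : mat d :=
  reduced (block 1 m (dperm_matrix e)).

Lemma window_edge d m k (M : mat d) (e : dperm d m.+1) :
  reduced (block k m.+1 M) = dperm_matrix e ->
  window_pred e = reduced (block k m M) /\
  window_succ e = reduced (block k.+1 m M).
Proof.
move=> eq_e; have eq_red : reduced (dperm_matrix e) = reduced (block k m.+1 M).
  by rewrite reduced_dperm_matrix.
split; first by rewrite /window_pred (reduced_block_eq _ _ eq_red)
                        block_block ?addn0 ?leqnSn.
by rewrite /window_succ (reduced_block_eq _ _ eq_red) block_block ?addn1.
Qed.

Definition rotate d m (e : dperm d m.+1) : dperm d m.+1 :=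
  [tuple (perm (can_inj (@ord_predK m.+1)) * tnth e j)%g | j < d.-1].

Lemma rotate_inj d m : injective (@rotate d m).
Proof.
move=> e f eq_ef; apply: eq_from_tnth => j;
apply: (@mulgI _ (perm (can_inj (@ord_predK m.+1)))).
by have := congr1 (fun t => tnth t j) eq_ef; rewrite !tnth_mktuple.
Qed.

(** Moving the last column of a window to the front turns its first columns
    into its last ones: every pattern has as many predecessors as successors
    in the overlap graph. *)
Lemma succ_rotate d m (e : dperm d m.+1) :
  window_succ (rotate e) = window_pred e.
Proof.
congr reduced; apply: matP => [|i j]; rewrite !size_block ?size_dperm_matrix //.
move=> lt_i; rewrite !entry_block // add0n add1n.
have lt_i1 : i.+1 < m.+1 by [].
rewrite (entry_dperm_matrix _ (Ordinal lt_i1)).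
rewrite (entry_dperm_matrix _ (Ordinal (ltnW lt_i1))).
(* [ord_pred] sends [i.+1] to [i]. *)
rewrite tnth_mktuple permM permE; congr ((tnth e j _).+1 : nat).
by apply: val_inj; rewrite /= modnDr modn_small // ltnW.
Qed.

(** * Extensions *)

Lemma size_lex_indices d m : size (lex_indices d m) = m.+1 ^ d.-1.
Proof. by rewrite size_sort -cardE card_tuple card_ord. Qed.

Lemma lex_coord_bounds d m i (j : 'I_d.-1) : 0 < lex_coord m i j <= m.+1.
Proof. exact: ltn_ord. Qed.

Lemma lex_coord_surj d m (t : 'I_d.-1 -> nat) : (forall j, t j <= m) ->
  exists2 i, 0 < i <= m.+1 ^ d.-1 & forall j, lex_coord m i j = (t j).+1.
Proof.
move=> le_t; pose u : d.-1.-tuplelexi 'I_m.+1 := [tuple inord (t j) | j < d.-1].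
have u_lex : u \in lex_indices d m by rewrite mem_sort mem_enum.
exists (index u (lex_indices d m)).+1.
  by rewrite -size_lex_indices index_mem.
by move=> j; rewrite /lex_coord /= nth_index // tnth_mktuple inordK // ltnS.
Qed.

Lemma nth_lex_indices_mono d m x0 i i' : i <= i' < m.+1 ^ d.-1 ->
  (nth x0 (lex_indices d m) i <= nth x0 (lex_indices d m) i')%O.
Proof.
move=> /andP[le_i lt_i'].
apply: (sorted_leq_nth le_trans le_refl) => //.
- by apply: sort_sorted; exact: le_total.
- by rewrite inE size_lex_indices; exact: leq_ltn_trans lt_i'.
- by rewrite inE size_lex_indices.
Qed.

Lemma lex_coord_first d m (j : 'I_d.-1) : lex_coord m 1 j = 1.
Proof.
have [i /andP[i_gt0 le_i] coord_i] := @lex_coord_surj d m (fun=> 0) (fun=> leq0n m).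
pose x0 : d.-1.-tuplelexi 'I_m.+1 := nseq_tuple d.-1 ord0.
suff eq_i : nth x0 (lex_indices d m) 1.-1 = nth x0 (lex_indices d m) i.-1.
  rewrite -[RHS](coord_i j).
  exact: (congr1 (fun u : d.-1.-tuple 'I_m.+1 => (tnth u j).+1 : nat) eq_i).
apply/le_anti/andP; split; first by apply: nth_lex_indices_mono; lia.
have -> : nth x0 (lex_indices d m) i.-1 = \bot%O; last exact: le0x.
rewrite botEtlexi; apply: eq_from_tnth => j'; rewrite tnth_mktuple.
by apply: val_inj; apply: succn_inj; exact: coord_i.
Qed.

Lemma lex_coord_last d m i : 0 < i <= m.+1 ^ d.-1 ->
  (forall j : 'I_d.-1, lex_coord m i j = m.+1) ->
  forall i', 0 < i' <= m.+1 ^ d.-1 -> i' <= i.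
Proof.
move=> /andP[i_gt0 le_i] coord_i i' /andP[i'_gt0 le_i'].
rewrite leqNgt; apply/negP => lt_ii'.
pose x0 : d.-1.-tuplelexi 'I_m.+1 := nseq_tuple d.-1 ord0.
have top_i : nth x0 (lex_indices d m) i.-1 = \top%O.
  rewrite topEtlexi; apply: eq_from_tnth => j; rewrite tnth_mktuple.
  by apply: val_inj; apply: succn_inj; exact: coord_i.
have top_i' : nth x0 (lex_indices d m) i'.-1 = \top%O.
  apply/le_anti; rewrite lex1 -top_i nth_lex_indices_mono //; lia.
have uniq_lex : uniq (lex_indices d m) by rewrite sort_uniq; exact: enum_uniq.
suff /eqP : i.-1 == i'.-1 by lia.
rewrite -(nth_uniq x0 _ _ uniq_lex) ?size_lex_indices; try lia.
by rewrite top_i top_i'.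
Qed.

(** This covers both cases of the definition: the maximum plus one lies above
    all entries, as the largest coordinate demands. *)
Lemma ext_last_count d (P : mat d) i j : distinct_rows P ->
  count (fun x => x < ext_last P i j) (mrow P j) = (lex_coord (size P) i j).-1.
Proof.
move=> dP; rewrite ffunE; lazy zeta; have := lex_coord_bounds (size P) i j.
set k := lex_coord (size P) i j; case: ifP => [le_k /andP[k_gt0 _]|gt_k le_k].
  have lt_k : k.-1 < size (sort leq (mrow P j)).
    by rewrite size_sort size_mrow prednK.
  rewrite -index_sort_count; last by rewrite -(mem_sort leq) mem_nth.
  by rewrite index_uniq // sort_uniq distinct_rows_uniq.
have -> : k.-1 = size (mrow P j) by rewrite size_mrow; lia.
apply/eqP; rewrite -all_count; apply/allP => x P_x.
by rewrite ltnS; exact: (@leq_bigmax_seq nat _ xpredT id).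
Qed.

Lemma lt_ext_last d (P : mat d) i i' j : distinct_rows P -> i' < size P ->
  (entry P i' j < ext_last P i j) =
  (count (fun x => x < entry P i' j) (mrow P j) < (lex_coord (size P) i j).-1).
Proof.
by move=> dP lt_i'; rewrite -ext_last_count // count_lt_mono ?entry_mrow.
Qed.

Lemma ext_last_le d (P : mat d) i j y : 0 < size P ->
  (forall i', i' < size P -> entry P i' j < y) -> ext_last P i j <= y.
Proof.
move=> P_gt0 lt_y.
have {}lt_y x : x \in mrow P j -> x < y by case/mem_mrow => i' ? ->; exact: lt_y.
rewrite ffunE; lazy zeta; have := lex_coord_bounds (size P) i j.
case: ifP => [le_k /andP[k_gt0 _]|_ _].
  apply/ltnW/lt_y; rewrite -(mem_sort leq) mem_nth // size_sort size_mrow.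
  by rewrite prednK.
have y_gt0 : 0 < y by apply: leq_ltn_trans (lt_y _ (entry_mrow j P_gt0)).
rewrite big_seq_cond.
elim/big_rec: _ => // x z; rewrite andbT => /lt_y lt_x lt_z.
by rewrite gtn_max lt_x.
Qed.

Lemma size_append_last d (M : mat d) B : size (append_last M B) = (size M).+1.
Proof. by rewrite size_rcons size_map. Qed.

Lemma entry_append_last_old d (M : mat d) B i j : i < size M ->
  entry (append_last M B) i j =
    if B j <= entry M i j then (entry M i j).+1 else entry M i j.
Proof.
move=> lt_i; rewrite /entry nth_rcons size_map lt_i (nth_map [ffun=> 0]) //.
by rewrite ffunE.
Qed.

Lemma entry_append_last_new d (M : mat d) B j :
  entry (append_last M B) (size M) j = B j.
Proof. by rewrite /entry nth_rcons size_map ltnn eqxx. Qed.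

Lemma append_last_old_lt d (M : mat d) B i i' j : i < size M -> i' < size M ->
  (entry (append_last M B) i j < entry (append_last M B) i' j) =
  (entry M i j < entry M i' j).
Proof.
move=> lt_i lt_i'; rewrite !entry_append_last_old //.
by case: ifP => ?; case: ifP => ?; apply/idP/idP; lia.
Qed.

Lemma append_last_lt_new d (M : mat d) B i j : i < size M ->
  (entry (append_last M B) i j < entry (append_last M B) (size M) j) =
  (entry M i j < B j).
Proof.
move=> lt_i; rewrite entry_append_last_new entry_append_last_old //.
by case: ifP => ?; apply/idP/idP; lia.
Qed.

Lemma append_last_new_lt d (M : mat d) B i j : i < size M ->
  (entry (append_last M B) (size M) j < entry (append_last M B) i j) =
  (B j <= entry M i j).
Proof.
move=> lt_i; rewrite entry_append_last_new entry_append_last_old //.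
by case: ifP => ?; apply/idP/idP; lia.
Qed.

Lemma distinct_rows_append_last d (M : mat d) B :
  distinct_rows M -> distinct_rows (append_last M B).
Proof.
move=> dM i i' j; rewrite size_append_last.
rewrite ltnS leq_eqVlt => lt_i; rewrite ltnS leq_eqVlt => lt_i'.
case/predU1P: lt_i lt_i' => [->|lt_i] /predU1P[->|lt_i'] //.
- by rewrite entry_append_last_new entry_append_last_old //; case: ifP => ? ?; lia.
- by rewrite entry_append_last_new entry_append_last_old //; case: ifP => ? ?; lia.
rewrite !entry_append_last_old // => eq_e; apply: (dM _ _ j) => //.
by move: eq_e; case: ifP => ?; case: ifP => ?; lia.
Qed.

Lemma block_append_last d a (M : mat d) B l : a + l <= size M ->
  same_order (block a l (append_last M B)) (block a l M).
Proof.
move=> le_al; have le_alS : a + l <= size (append_last M B).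
  by rewrite size_append_last; exact: leqW.
split=> [|i i' j]; rewrite !size_block // => lt_i lt_i'.
by rewrite !entry_block // append_last_old_lt //; lia.
Qed.

Lemma block_append_last_end d k m (M : mat d) B : size M = k + m ->
  block k m.+1 (append_last M B) = append_last (block k m M) B.
Proof.
move=> sz_M; rewrite /block !take_oversize ?size_drop ?size_append_last; try lia.
by rewrite /append_last /incr_ge drop_rcons ?map_drop // size_map sz_M leq_addr.
Qed.

(** The last column of [W] is determined up to order by how many earlier entries
    lie below it in each row, and every choice of these numbers is the index of
    some extension. *)
Lemma extension_complete d m (P : mat d) (W : mat d) :
  distinct_rows P -> size P = m -> size W = m.+1 -> distinct_rows W ->
  reduced (block 0 m W) = reduced P ->
  exists2 i, 0 < i <= m.+1 ^ d.-1 & reduced (extension P i) = reduced W.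
Proof.
move=> dP sz_P sz_W dW /reducedP [_ ltWP].
pose W' := block 0 m W.
have sz_W' : size W' = m by rewrite size_block // sz_W.
rewrite -/W' sz_W' in ltWP.
pose t j := count (fun x => x < entry W m j) (mrow W' j).
have t_le j : t j <= m by rewrite -sz_W' -(size_mrow W' j) count_size.
have [i i_bounds coord_i] := lex_coord_surj t_le.
exists i => //; apply/reducedP.
have eW i' j : i' < m -> entry W i' j = entry W' i' j.
  by move=> lt_i'; rewrite entry_block.
have count_eq i' j : i' < m ->
  count (fun x => x < entry P i' j) (mrow P j) =
  count (fun x => x < entry W' i' j) (mrow W' j).
  move=> lt_i'; rewrite !mrowE sz_W' sz_P !count_map.
  by apply: eq_in_count => k; rewrite mem_iota => lt_k /=; rewrite ltWP.
have lt_last i' j : i' < m ->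
  (entry P i' j < ext_last P i j) = (entry W i' j < entry W m j).
  move=> lt_i'; rewrite lt_ext_last ?sz_P // coord_i /= count_eq //.
  by rewrite (eW i') // count_lt_mono // entry_mrow ?sz_W'.
have neW i' j : i' < m -> entry W i' j != entry W m j.
  by move=> lt_i'; apply/eqP => /dW; rewrite sz_W; lia.
split=> [|i1 i2 j]; rewrite size_append_last sz_P //.
rewrite ltnS leq_eqVlt => lt1; rewrite ltnS leq_eqVlt => lt2.
case/predU1P: lt1 lt2 => [->|lt1] /predU1P[->|lt2].
- by rewrite !ltnn.
- rewrite -sz_P append_last_new_lt ?sz_P // leqNgt lt_last //.
  by have := neW i2 j lt2; lia.
- have := @append_last_lt_new d P (ext_last P i) i1 j; rewrite sz_P => -> //.
  exact: lt_last.
- by rewrite append_last_old_lt ?sz_P // -ltWP // !eW.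
Qed.

Lemma extension_last_max d (P : mat d) i (j : 'I_d.-1) : distinct_rows P ->
  last_max (extension P i) -> lex_coord (size P) i j = (size P).+1.
Proof.
move=> dP lmP; case/andP: (lex_coord_bounds (size P) i j) => k_gt0 _.
rewrite -(prednK k_gt0) -ext_last_count // -[X in _ = X.+1](size_mrow P j).
congr _.+1; apply/eqP; rewrite -all_count; apply/allP => x /mem_mrow[i' lt_i' ->].
have := lmP i' j; rewrite size_append_last /= append_last_lt_new // ltnS.
exact.
Qed.

(** * Greedy trails in balanced graphs *)

Lemma count_le_card (E : finType) (p : pred E) s : uniq s -> count p s <= #|p|.
Proof.
move=> uniq_s; rewrite -size_filter cardE; apply: uniq_leq_size.
  exact: filter_uniq.
by move=> e; rewrite mem_filter => /andP[p_e _]; rewrite mem_enum.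
Qed.

Lemma card_le_count (E : finType) (p : pred E) s :
  (forall e, p e -> e \in s) -> #|p| <= count p s.
Proof.
move=> p_s; rewrite -size_filter cardE; apply: uniq_leq_size.
  exact: enum_uniq.
by move=> e; rewrite mem_enum mem_filter unfold_in => p_e; rewrite p_e p_s.
Qed.

Lemma count_card_mem (E : finType) (p : pred E) s : uniq s ->
  #|p| <= count p s -> forall e, p e -> e \in s.
Proof.
move=> uniq_s; rewrite -size_filter cardE => le_sz e p_e.
have [|_ mem_eq] := uniq_min_size (filter_uniq p uniq_s) _ le_sz.
  by move=> f; rewrite mem_filter => /andP[p_f _]; rewrite mem_enum.
suff: e \in filter p s by rewrite mem_filter => /andP[].
by rewrite mem_eq mem_enum.
Qed.

Section BalancedTrail.

Variables (E : finType) (V : eqType) (src tgt : E -> V).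
Variables (R : E -> E) (R_inj : injective R) (tgtR : forall e, tgt (R e) = src e).
Variables (T : nat) (es : nat -> E) (vs : nat -> V).
Hypothesis es_uniq : uniq (mkseq es T).
Hypothesis src_es : forall k, k < T -> src (es k) = vs k.
Hypothesis tgt_es : forall k, k < T -> tgt (es k) = vs k.+1.
Hypothesis stuck : forall e, src e = vs T -> e \in mkseq es T.

Lemma trail_balance v :
  count (fun e => src e == v) (mkseq es T) + (vs T == v) =
  count (fun e => tgt e == v) (mkseq es T) + (vs 0 == v).
Proof.
move: src_es tgt_es; clear; elim: T => [//|t IH] src_es tgt_es.
have {}IH := IH (fun k lt_k => src_es (leqW lt_k))
               (fun k lt_k => tgt_es (leqW lt_k)).
rewrite mkseqS -cats1 !count_cat /= src_es // tgt_es // !addn0.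
by rewrite IH addnAC.
Qed.

Lemma card_src_tgt v : #|[pred e | src e == v]| = #|[pred e | tgt e == v]|.
Proof.
have <- : #|R @^-1: [set e | tgt e == v]| = #|[pred e | tgt e == v]|.
  by rewrite card_preimset // cardsE; apply: eq_card => e; rewrite !inE.
by rewrite -[RHS]cardsE; apply: eq_card => e; rewrite !inE tgtR.
Qed.

(** A trail that is at a vertex other than its start has entered it once more
    than it has left it; as equally many edges lead in and out, an unused way
    out remains. *)
Lemma stuck_closed : vs T = vs 0.
Proof.
apply/eqP; rewrite eq_sym; apply/negPn/negP => /negbTE ne_v.
suff: count (fun e => tgt e == vs T) (mkseq es T) <=
      count (fun e => src e == vs T) (mkseq es T).
  have := trail_balance (vs T); rewrite eqxx ne_v addn0 addn1 => <-.
  by rewrite ltnn.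
apply: leq_trans (count_le_card _ es_uniq) _; rewrite -card_src_tgt.
by apply: card_le_count => e /eqP; exact: stuck.
Qed.

Lemma exhausted_in v : (forall e, src e = v -> e \in mkseq es T) ->
  forall e, tgt e = v -> e \in mkseq es T.
Proof.
move=> out_v e tgt_e; apply: (@count_card_mem _ [pred e | tgt e == v]) => //=.
  rewrite -card_src_tgt.
  have := trail_balance v; rewrite stuck_closed => /addIn <-.
  by apply: card_le_count => f /eqP; exact: out_v.
exact/eqP.
Qed.

Variable lastresort : E -> Prop.
Hypothesis lastresort_last : forall e f,
  lastresort e -> e \in mkseq es T -> src f = src e -> f \in mkseq es T.
Variable level : nat -> V -> Prop.
Hypothesis level0 : forall v, level 0 v -> v = vs 0.
Hypothesis level_step : forall a e, level a.+1 (src e) ->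
  exists2 f, src f = src e & lastresort f /\ level a (tgt f).

(** A vertex all of whose outgoing edges are used has all its incoming edges
    used as well; in particular the last resort of each vertex leading to it,
    and hence every edge leaving that vertex.  So exhaustion spreads from the
    start backwards along the edges of last resort. *)
Lemma level_exhausted a e : level a (src e) -> e \in mkseq es T.
Proof.
elim: a e => [|a IH] e.
  by move/level0; rewrite -stuck_closed; exact: stuck.
move/level_step => [f src_f [lr_f lv_f]].
apply: (lastresort_last lr_f); last by rewrite src_f.
by apply: (@exhausted_in (tgt f)) => // g src_g; apply: IH; rewrite src_g.
Qed.

End BalancedTrail.

(** * Runs of the greedy algorithm *)

Lemma ohead_filter_iota (p : pred nat) a N i :
  ohead [seq x <- iota a N | p x] = Some i ->
  [/\ a <= i < a + N, p i & forall i', a <= i' < i -> ~~ p i'].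
Proof.
elim: N a => //= N IH a; case: ifP => [p_a [<-]|np_a /IH[bounds p_i min_i]].
  by split=> // *; lia.
split=> // [|i' bounds']; first lia.
by have [->|ne_a] := eqVneq i' a; rewrite ?np_a // min_i //; lia.
Qed.

Lemma red_occursP d m k (W M : mat d) : size M = k + m ->
  reflect (exists2 a, a < k & reduced (block a m.+1 M) = reduced W)
          (red_occurs m.+1 W M).
Proof.
move=> sz_M; rewrite /red_occurs /windows sz_M subSS addnK has_map.
apply: (iffP hasP) => [[a]|[a lt_a eq_a]].
  by rewrite mem_iota => lt_a /eqP; exists a.
by exists a; rewrite ?mem_iota //; exact/eqP.
Qed.

Lemma last_columns_block d m k (M : mat d) : size M = k + m ->
  last_columns m M = block k m M.
Proof.
by move=> sz; rewrite /last_columns /block sz addnK take_oversize // size_drop; lia.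
Qed.

Lemma greedy_step_some d m k (M M' : mat d) : size M = k + m ->
  greedy_step m.+1 M = Some M' ->
  let P := block k m M in
  exists i, [/\ 0 < i <= m.+1 ^ d.-1, M' = append_last M (ext_last P i),
    ~~ red_occurs m.+1 (extension P i) M &
    forall i', 0 < i' < i -> red_occurs m.+1 (extension P i') M].
Proof.
move=> sz_M; rewrite /greedy_step (last_columns_block sz_M) /=.
rewrite size_block ?sz_M //; set s := [seq _ <- _ | _].
case eq_s: (ohead s) => [i|//] /= [<-].
have [bounds new_i min_i] := ohead_filter_iota eq_s.
by exists i; split=> // i' /min_i; rewrite negbK.
Qed.

Lemma greedy_step_none d m k (M : mat d) : size M = k + m ->
  greedy_step m.+1 M = None -> forall i, 0 < i <= m.+1 ^ d.-1 ->
  red_occurs m.+1 (extension (block k m M) i) M.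
Proof.
move=> sz_M; rewrite /greedy_step (last_columns_block sz_M) /=.
rewrite size_block ?sz_M //; set s := [seq _ <- _ | _].
case eq_s: s => [|//] _ i bounds; apply/negPn/negP => new_i.
suff: i \in s by rewrite eq_s.
by rewrite mem_filter new_i mem_iota; lia.
Qed.

(** What is true of the matrix after [k] steps.  The first [m] columns stay
    increasing and above all others, which is what makes the cyclic closure
    work; and whenever the window of last resort is used, the greedy rule has
    already used all its competitors. *)
Record greedy_inv d m k (M : mat d) : Prop := GreedyInv {
  inv_size : size M = k + m;
  inv_distinct : distinct_rows M;
  inv_windows : forall a b, a < b < k ->
    reduced (block a m.+1 M) <> reduced (block b m.+1 M);
  inv_start_inc : forall i i' j, i < i' < m -> entry M i j < entry M i' j;
  inv_start_top : forall i l j, i < m -> m <= l < k + m ->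
    entry M l j < entry M i j;
  inv_last_resort : forall t (p : dperm d m.+1), t < k ->
    last_max (block t m.+1 M) -> window_pred p = reduced (block t m M) ->
    exists2 t', t' <= t & reduced (block t' m.+1 M) = dperm_matrix p
}.

Lemma entry_id_matrix d m i (j : 'I_d.-1) : i < m ->
  entry (id_matrix d m) i j = i.+1.
Proof.
by move=> lt_i; rewrite /entry (nth_map 0) ?size_iota // ffunE nth_iota.
Qed.

Lemma greedy_inv0 d m : greedy_inv m 0 (id_matrix d m).
Proof.
have sz : size (id_matrix d m) = m by rewrite size_map size_iota.
split=> //.
- by move=> i i' j; rewrite sz => lt_i lt_i'; rewrite !entry_id_matrix // => -[].
- by move=> a b; rewrite andbC.
- by move=> i i' j lt_i; rewrite !entry_id_matrix; lia.
- by move=> i l j _; lia.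
Qed.

(** During the first [m] steps any extension is new: its window descends from
    the last initial column to the first appended one, at a place where each
    earlier window still ascends along the initial columns.  So the algorithm
    takes the lexicographically first one, which appends minima. *)
Lemma early_extension_new d m k (M : mat d) (j0 : 'I_d.-1) i :
  greedy_inv m k M -> k < m -> ~~ red_occurs m.+1 (extension (block k m M) i) M.
Proof.
move=> inv lt_km; have sz_M := inv_size inv.
apply/(red_occursP _ sz_M) => -[a lt_ak].
rewrite /extension -(block_append_last_end _ sz_M); set B := ext_last _ i.
move/reducedP => [_ /(_ (m.-1 - k) (m - k) j0)].
rewrite size_block ?sz_M; last by lia.
rewrite !entry_block; try lia.
rewrite (inv_start_inc inv); last by lia.
move=> /(_ ltac:(lia) ltac:(lia)); rewrite append_last_old_lt ?sz_M; try lia.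
have := @inv_start_top _ _ _ _ inv (k + (m.-1 - k)) (k + (m - k)) j0.
by move=> /(_ ltac:(lia) ltac:(lia)); lia.
Qed.

Lemma greedy_inv_step d m k (M M' : mat d) (j0 : 'I_d.-1) : 0 < m ->
  greedy_inv m k M -> greedy_step m.+1 M = Some M' -> greedy_inv m k.+1 M'.
Proof.
move=> m_gt0 inv step; have sz_M := inv_size inv.
have [i [i_bounds -> new_i min_i]] := greedy_step_some sz_M step.
set P := block k m M in i_bounds new_i min_i *.
have sz_P : size P = m by rewrite size_block ?sz_M.
have dP : distinct_rows P by apply: distinct_rows_block; exact: inv_distinct inv.
set B := ext_last P i.
have old a l : a + l <= k + m ->
  reduced (block a l (append_last M B)) = reduced (block a l M).
  by move=> le_al; apply/reducedP/block_append_last; rewrite sz_M.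
have new : block k m.+1 (append_last M B) = extension P i.
  exact: block_append_last_end.
have B_le_start i' j : i' < m -> B j <= entry M i' j.
  move=> lt_i'; have [le_mk|lt_km] := leqP m k.
    apply: ext_last_le; rewrite ?sz_P // => l lt_l; rewrite entry_block //.
    by apply: (inv_start_top inv); lia.
  have i_eq1 : i = 1.
    have [lt1i|] := ltnP 1 i; last by lia.
    by case/negP: (@early_extension_new _ _ _ _ j0 1 inv lt_km); exact: min_i.
  have B_min l : l < m -> B j <= entry P l j.
    move=> lt_l; rewrite leqNgt lt_ext_last ?sz_P // i_eq1.
    by rewrite lex_coord_first ltn0.
  have [le_ki'|lt_i'k] := leqP k i'.
    by have := B_min (i' - k); rewrite entry_block ?subnKC //; [apply | ]; lia.
  apply: leq_trans (B_min (m - k) _) _; first by lia.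
  rewrite entry_block; last by lia.
  by apply/ltnW/(inv_start_top inv); lia.
split.
- by rewrite size_append_last sz_M.
- exact/distinct_rows_append_last/(inv_distinct inv).
- move=> a b /andP[lt_ab]; rewrite ltnS leq_eqVlt => /predU1P[eq_bk|lt_bk].
    rewrite eq_bk new old; last by lia.
    move=> eq_red; case/negP: new_i; apply/(red_occursP _ sz_M).
    by exists a => //; rewrite -eq_bk.
  by rewrite !old; try lia; apply: (inv_windows inv); rewrite lt_ab.
- move=> i1 i2 j lt_i; rewrite append_last_old_lt ?sz_M; try lia.
  exact: inv_start_inc inv _ _ _ _.
- move=> i1 l j lt_i1 /andP[le_ml]; rewrite addSn ltnS leq_eqVlt.
  case/predU1P => [->|lt_l].
    by rewrite -sz_M append_last_new_lt ?B_le_start // sz_M; lia.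
  by rewrite append_last_old_lt ?sz_M; try lia; apply: (inv_start_top inv); lia.
move=> t p; rewrite ltnS leq_eqVlt => /predU1P[->|lt_t].
  rewrite new old // => lm_i eq_p.
  have [||i' i'_bounds eq_i'] := extension_complete dP sz_P _ _ eq_p.
  - exact: size_dperm_matrix.
  - exact: distinct_rows_dperm.
  have le_i'i : i' <= i.
    apply: lex_coord_last i_bounds _ _ i'_bounds => j.
    by rewrite -[in LHS]sz_P -[in RHS]sz_P extension_last_max.
  rewrite reduced_dperm_matrix in eq_i'.
  have [eq_ii'|lt_i'i] := eqVneq i' i.
    by exists k => //; rewrite new -eq_ii'.
  have /(red_occursP _ sz_M)[a lt_ak eq_a] : red_occurs m.+1 (extension P i') M.
    by apply: min_i; lia.
  by exists a; [exact: ltnW | rewrite old ?eq_a //; lia].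
rewrite old; last by lia.
move=> lm eq_p.
have lm_M : last_max (block t m.+1 M).
  by apply: last_max_same_order lm; apply: block_append_last; rewrite sz_M; lia.
have [t' le_t' eq_t'] := inv_last_resort inv lt_t lm_M eq_p.
by exists t' => //; rewrite old //; lia.
Qed.

Lemma greedy_state_inv d m k (M : mat d) (j0 : 'I_d.-1) : 0 < m ->
  greedy_state d m.+1 k = Some M -> greedy_inv m k M.
Proof.
move=> m_gt0; elim: k M => [|k IH] M; first by case=> <-; exact: greedy_inv0.
rewrite /greedy_state iterS -/(greedy_state d m.+1 k).
case eq_k: (greedy_state d m.+1 k) => [M0|//] /= step.
exact: greedy_inv_step j0 m_gt0 (IH _ eq_k) step.
Qed.

Lemma window_pattern_exists d m k t (M : mat d) : greedy_inv m k M -> t < k ->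
  exists p : dperm d m.+1, reduced (block t m.+1 M) = dperm_matrix p.
Proof.
move=> inv lt_t; apply: pattern_exists.
  by rewrite size_block // (inv_size inv); lia.
exact/distinct_rows_block/(inv_distinct inv).
Qed.

Definition window_label d m (M : mat d) (t : nat) : dperm d m.+1 :=
  odflt [tuple 1%g | _ < d.-1]
    [pick p | reduced (block t m.+1 M) == dperm_matrix p].

Lemma window_labelE d m k t (M : mat d) : greedy_inv m k M -> t < k ->
  reduced (block t m.+1 M) = dperm_matrix (window_label m M t).
Proof.
move=> inv lt_t; have [p eq_p] := window_pattern_exists inv lt_t.
by rewrite /window_label; case: pickP => [q /eqP //|/(_ p)]; rewrite eq_p eqxx.
Qed.

Lemma window_index_inj d m k t t' (M : mat d) : greedy_inv m k M ->
  t < k -> t' < k ->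
  reduced (block t m.+1 M) = reduced (block t' m.+1 M) -> t = t'.
Proof.
move=> inv lt_t lt_t' eq_t; have [lt|lt|//] := ltngtP t t'.
  by case: (inv_windows inv _ eq_t); rewrite lt.
by case: (inv_windows inv _ (esym eq_t)); rewrite lt.
Qed.

Lemma window_labels_uniq d m k (M : mat d) : greedy_inv m k M ->
  uniq (mkseq (window_label m M) k).
Proof.
move=> inv; rewrite map_inj_in_uniq ?iota_uniq // => t t'.
rewrite !mem_iota !add0n /= => lt_t lt_t' eq_l.
by apply: (window_index_inj inv) => //; rewrite !(window_labelE inv) // eq_l.
Qed.

Lemma mem_window_labels d m k (M : mat d) p : greedy_inv m k M ->
  reflect (exists2 t, t < k & reduced (block t m.+1 M) = dperm_matrix p)
          (p \in mkseq (window_label m M) k).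
Proof.
move=> inv; apply: (iffP mapP) => [[t]|[t lt_t eq_t]].
  by rewrite mem_iota => lt_t ->; exists t; last exact: window_labelE inv _.
exists t; first by rewrite mem_iota.
by apply: dperm_matrix_inj; rewrite -(window_labelE inv).
Qed.

Lemma greedy_inv_bound d m k (M : mat d) : greedy_inv m k M ->
  k <= #|{: dperm d m.+1}|.
Proof.
move=> /window_labels_uniq uniq_l; rewrite -(size_mkseq (window_label m M) k).
by rewrite -(card_uniqP uniq_l) max_card.
Qed.

Lemma greedy_output_exists d m (j0 : 'I_d.-1) : 0 < m ->
  exists U : mat d, greedy_output m.+1 U.
Proof.
move=> m_gt0.
have run k : (exists U : mat d, greedy_output m.+1 U) \/
             (exists M, greedy_state d m.+1 k = Some M).
  elim: k => [|k [|[M eq_M]]]; [by right; eexists | by left |].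
  case step: (greedy_step m.+1 M) => [M'|]; last by left; exists M, k.
  by right; exists M'; rewrite /greedy_state iterS -/(greedy_state _ _ _) eq_M.
have [//|[M /(greedy_state_inv j0 m_gt0)/greedy_inv_bound]] :=
  run #|{: dperm d m.+1}|.+1.
by rewrite ltnn.
Qed.

Lemma last_resort_exists d m (e : dperm d m.+1) : exists2 f : dperm d m.+1,
  window_pred f = window_pred e & last_max (dperm_matrix f).
Proof.
pose W := block 0 m (dperm_matrix e).
have sz_W : size W = m by rewrite size_block ?size_dperm_matrix.
(* The entries of a matrix of permutations are at most [m.+1]. *)
pose B : column d := [ffun=> m.+2]; pose U := append_last W B.
have lt_B i j : i < m -> entry W i j < B j.
  move=> lt_i; rewrite entry_block // ffunE add0n.
  by rewrite (entry_dperm_matrix e (Ordinal (leqW lt_i))) ltnS ltn_ord.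
have sz_U : size U = m.+1 by rewrite size_append_last sz_W.
have dU : distinct_rows U.
  exact/distinct_rows_append_last/distinct_rows_block/distinct_rows_dperm.
have [f eq_f] := pattern_exists sz_U dU.
have block_U : block 0 m.+1 U = U by rewrite /block drop0 take_oversize ?sz_U.
exists f.
  have [-> _] := @window_edge d m 0 U f (etrans (congr1 _ block_U) eq_f).
  rewrite /window_pred; apply/reducedP.
  have := @block_append_last d 0 W B m; rewrite sz_W => /(_ (leqnn m)).
  by rewrite block_block.
rewrite -eq_f; apply: last_max_same_order (same_order_sym (same_order_reduced U)) _.
move=> i j; rewrite sz_U ltnS => lt_i /=.
by have := @append_last_lt_new d W B i j; rewrite sz_W => ->; rewrite ?lt_B.
Qed.

(** * The output of the algorithm *)

Section Stuck.

Variables (d m T : nat) (M : mat d).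
Hypothesis inv : greedy_inv m T M.
Hypothesis stuck : greedy_step m.+1 M = None.

Let src_label t : t < T -> window_pred (window_label m M t) = reduced (block t m M).
Proof. by move=> lt_t; have [] := window_edge (window_labelE inv lt_t). Qed.

Let succ_label t : t < T ->
  window_succ (window_label m M t) = reduced (block t.+1 m M).
Proof. by move=> lt_t; have [] := window_edge (window_labelE inv lt_t). Qed.

Let stuck_label e : window_pred e = reduced (block T m M) ->
  e \in mkseq (window_label m M) T.
Proof.
move=> pred_e; apply/(mem_window_labels _ inv); have sz_M := inv_size inv.
have dP : distinct_rows (block T m M).
  by apply: distinct_rows_block; exact: inv_distinct inv.
have sz_P : size (block T m M) = m by rewrite size_block ?sz_M.
have [||i i_bounds] := extension_complete dP sz_P _ _ pred_e.
- exact: size_dperm_matrix.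
- exact: distinct_rows_dperm.
rewrite reduced_dperm_matrix => <-.
by have /(red_occursP _ sz_M) := greedy_step_none sz_M stuck i_bounds.
Qed.

Lemma final_block_start : reduced (block T m M) = reduced (block 0 m M).
Proof.
exact: (stuck_closed (@rotate_inj d m) (@succ_rotate d m)
  (window_labels_uniq inv) src_label succ_label stuck_label).
Qed.

Lemma start_increasing : increasing (block 0 m M).
Proof.
move=> i i' j; rewrite size_block ?(inv_size inv) ?leq_addl // => lt_i.
by rewrite !entry_block; try lia; exact: inv_start_inc inv _ _ _ lt_i.
Qed.

(** Following last resorts [m] times from any vertex pushes out all its columns
    in favour of increasing ones, and so leads back to the start. *)
Lemma all_patterns_used (e : dperm d m.+1) : exists2 t, t < T &
  reduced (block t m.+1 M) = dperm_matrix e.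
Proof.
(* Apart from the first [a] columns the vertex is increasing, so that [a] last
   resorts lead to the start. *)
pose level a v := exists W : mat d, [/\ size W = m, v = reduced W &
  forall i i' j, a <= i < i' -> i' < m -> entry W i j < entry W i' j].
apply/(mem_window_labels _ inv).
apply: (@level_exhausted _ _ _ _ _ (@rotate_inj d m) (@succ_rotate d m) T
  (window_label m M) (fun k => reduced (block k m M)) (window_labels_uniq inv)
  src_label succ_label stuck_label
  (fun f : dperm d m.+1 => last_max (dperm_matrix f)) _ level _ _ m).
- move=> f g lm_f /(mem_window_labels _ inv)[t lt_t eq_f] src_g.
  apply/(mem_window_labels _ inv).
  have [t' le_t' eq_g] : exists2 t', t' <= t &
      reduced (block t' m.+1 M) = dperm_matrix g.
    apply: (inv_last_resort inv lt_t).
      apply: last_max_same_order lm_f; rewrite -eq_f; exact: same_order_reduced.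
    by rewrite src_g; have [] := window_edge eq_f.
  by exists t' => //; exact: leq_ltn_trans lt_t.
- move=> v [W [sz_W -> incW]]; apply/reducedP/same_order_increasing.
  + by rewrite size_block // (inv_size inv) leq_addl.
  + by move=> i i' j; rewrite sz_W => /andP[lt_i]; exact: incW.
  + exact: start_increasing.
- move=> a f [W [sz_W eq_W incW]]; have [g src_g lm_g] := last_resort_exists f.
  exists g => //; split=> //; exists (block 1 m (dperm_matrix g)); split=> //.
    by rewrite size_block ?size_dperm_matrix.
  move=> i i' j /andP[le_ai lt_ii'] lt_i'; rewrite !entry_block //; last by lia.
  have [eq_i'|ne_i'] := eqVneq i'.+1 m.
    have := lm_g i.+1 j; rewrite size_dperm_matrix /= !add1n eq_i'; apply; lia.
  have /reducedP[_ lt_gW] : reduced (block 0 m (dperm_matrix g)) = reduced W.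
    by rewrite -eq_W -src_g.
  have := lt_gW i.+1 i'.+1 j; rewrite size_block ?size_dperm_matrix //.
  rewrite !entry_block; try lia.
  by rewrite !add0n !add1n => -> //; try lia; apply: incW; lia.
exists (block 0 m (dperm_matrix e)); split=> //.
  by rewrite size_block ?size_dperm_matrix.
by move=> i i' j; lia.
Qed.

Lemma steps_card : T = #|{: dperm d m.+1}|.
Proof.
apply/eqP; rewrite eqn_leq (greedy_inv_bound inv) /=.
rewrite -(size_mkseq (window_label m M) T) cardE.
apply: uniq_leq_size => [|e _]; first exact: enum_uniq.
exact/(mem_window_labels _ inv)/all_patterns_used.
Qed.

(** The increasing pattern is the last resort of the start and leads back to
    the start, where nothing is left once it has been used. *)
Lemma last_window_increasing : increasing (block T.-1 m.+1 M).
Proof.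
have sz_I : size (id_matrix d m.+1) = m.+1 by rewrite size_map size_iota.
have incI : increasing (id_matrix d m.+1).
  by move=> i i' j; rewrite sz_I => lt_i; rewrite !entry_id_matrix; lia.
have [e eq_e] := pattern_exists sz_I (inv_distinct (greedy_inv0 d m.+1)).
have [t lt_t eq_t] := all_patterns_used e.
have inc_t : increasing (block t m.+1 M).
  by apply: increasing_same_order incI; apply/reducedP; rewrite eq_e eq_t.
have sz_M := inv_size inv.
have [<- //|ne_t] := eqVneq t.+1 T.
have lt_t1 : t.+1 < T by lia.
have eq_vs : reduced (block t.+1 m M) = reduced (block t m M).
  apply/reducedP/same_order_increasing; first by rewrite !size_block ?sz_M; lia.
    move=> i i' j; rewrite size_block ?sz_M; last by lia.
    move=> /andP[lt_i lt_i']; have := inc_t i.+1 i'.+1 j.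
    by rewrite size_block ?sz_M ?entry_block ?addSnnS //; [apply; lia | lia..].
  move=> i i' j; rewrite size_block ?sz_M; last by lia.
  move=> /andP[lt_i lt_i']; have := inc_t i i' j.
  by rewrite size_block ?sz_M ?entry_block //; [apply; lia | lia..].
have src_e' := src_label lt_t1; rewrite eq_vs in src_e'.
have [t' le_t' eq_t'] :=
  inv_last_resort inv lt_t (increasing_last_max inc_t) src_e'.
have : t' = t.+1; last by lia.
apply: (window_index_inj inv) => //; first by lia.
by rewrite eq_t' -(window_labelE inv).
Qed.

(** The last [m] edges are edges of last resort.  The columns from [T - 1] on
    are increasing, but column [T - 2] is not below column [T - 1] in all rows,
    for otherwise the increasing pattern would occur twice.  For [a >= 2] this
    failure sits at position [a - 2] of the vertex reached at time [T - a], where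
    every vertex reached later ascends.  So the vertex is left for the last time,
    hence by its last resort. *)
Lemma final_window_last_max a : 0 < a <= m -> a <= T ->
  last_max (block (T - a) m.+1 M).
Proof.
move=> /andP[a_gt0 le_am] le_aT; have sz_M := inv_size inv.
have inc_T := last_window_increasing.
have [->|ne_a1] := eqVneq a 1.
  by rewrite subn1; exact: increasing_last_max.
have lt_Ta : T - a < T by lia.
have [f src_f lm_f] := last_resort_exists (window_label m M (T - a)).
have [t lt_t eq_t] := all_patterns_used f.
have lm_t : last_max (block t m.+1 M).
  apply: last_max_same_order lm_f; rewrite -eq_t; exact: same_order_reduced.
have src_t : window_pred (window_label m M (T - a)) = reduced (block t m M).
  by rewrite -src_f; have [] := window_edge eq_t.
have [t' le_t' eq_t'] := inv_last_resort inv lt_t lm_t src_t.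
have eq_t'Ta : t' = T - a.
  by apply: (window_index_inj inv); rewrite ?eq_t' -?(window_labelE inv) //; lia.
have [<- //|ne_t] := eqVneq t (T - a).
have ascent j : entry M (T - 2) j < entry M T.-1 j.
  have /reducedP[_ /(_ (a - 2) a.-1 j)] :
      reduced (block (T - a) m M) = reduced (block t m M).
    by rewrite -src_label.
  rewrite size_block ?sz_M; last by lia.
  rewrite !entry_block; try lia.
  have -> : T - a + (a - 2) = T - 2 by lia.
  have -> : T - a + a.-1 = T.-1 by lia.
  move=> -> //; try lia.
  have := inc_T (t + (a - 2) - T.-1) (t + a.-1 - T.-1) j.
  rewrite size_block ?sz_M; last by lia.
  by rewrite !entry_block ?subnKC; [apply; lia | lia..].
have inc_T2 : increasing (block (T - 2) m.+1 M).
  move=> i i' j; rewrite size_block ?sz_M; last by lia.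
  move=> /andP[lt_i lt_i']; rewrite !entry_block; try lia.
  have inc_last k : 0 < k < i' -> entry M (T - 2 + k) j < entry M (T - 2 + i') j.
    move=> lt_k; have := inc_T k.-1 i'.-1 j.
    rewrite size_block ?sz_M; last by lia.
    rewrite !entry_block; try lia.
    have -> : T.-1 + k.-1 = T - 2 + k by lia.
    have -> : T.-1 + i'.-1 = T - 2 + i' by lia.
    by apply; lia.
  have [i0|i_gt0] := posnP i; last by apply: inc_last; lia.
  rewrite i0 addn0; have eq_T1 : T.-1 = T - 2 + 1 by lia.
  have [->|i'_ne1] := eqVneq i' 1; first by rewrite -eq_T1.
  by apply: ltn_trans (ascent j) _; rewrite eq_T1; apply: inc_last; lia.
have : T - 2 = T.-1; last by lia.
apply: (window_index_inj inv); try lia.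
by apply/reducedP/same_order_increasing => //; rewrite !size_block ?sz_M; lia.
Qed.

(** The initial columns are increasing and above the end of the matrix, just like
    the final columns whose place they take after wrapping around. *)
Lemma wrap_order c c' j : m + m <= T -> c < c' <= c + m -> T <= c' ->
  c' < T + m ->
  (entry M c j < entry M c' j) && (entry M (c %% T) j < entry M (c' %% T) j).
Proof.
move=> le_mmT /andP[lt_cc' le_c'] le_Tc' lt_c'.
have sz_M := inv_size inv.
have modT x : T <= x < T + T -> x %% T = x - T.
  move=> /andP[le_Tx lt_x].
  by rewrite -{1}(subnK le_Tx) modnDr modn_small // ltn_subLR.
rewrite (modT c'); last by lia.
have [lt_cT|le_Tc] := ltnP c T.
  have /(_ ltac:(lia) ltac:(lia) (c - (c' - m)) j) :=
    @final_window_last_max (T + m - c').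
  have -> : T - (T + m - c') = c' - m by lia.
  rewrite size_block ?sz_M; last by lia.
  rewrite !entry_block ?subnKC ?subnK /=; try lia.
  move=> -> //; try lia.
  by rewrite modn_small //; apply: (inv_start_top inv); lia.
rewrite modT; last by lia.
rewrite andbC (inv_start_inc inv) /=; last by lia.
have inc : increasing (block T m M).
  by apply: increasing_same_order start_increasing; apply/reducedP;
     rewrite final_block_start.
have := inc (c - T) (c' - T) j; rewrite size_block ?sz_M //.
by rewrite !entry_block ?subnKC; [apply; lia | lia..].
Qed.

Lemma cyclic_window_block k : m + m <= T -> k < T ->
  reduced (cyclic_window m.+1 (reduced (block 0 T M)) k) =
  reduced (block k m.+1 M).
Proof.
move=> le_mmT lt_k; have sz_M := inv_size inv.
have sz_U : size (block 0 T M) = T by rewrite size_block // sz_M leq_addr.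
have T_gt0 : 0 < T by lia.
apply/reducedP; split=> [|l l' j].
  by rewrite size_mkseq size_block // sz_M; lia.
rewrite size_mkseq => lt_l lt_l'.
have entryC i : i < m.+1 ->
    entry (cyclic_window m.+1 (reduced (block 0 T M)) k) i j =
    entry (reduced (block 0 T M)) ((k + i) %% T) j.
  by move=> lt_i; rewrite /entry nth_mkseq // size_reduced sz_U.
have [_ ltU] := same_order_reduced (block 0 T M).
rewrite !entryC // ltU ?size_reduced ?sz_U ?ltn_pmod //.
rewrite !entry_block ?ltn_pmod // !add0n.
have lt_wrap i i' : i < i' -> i' < m.+1 ->
    (entry M ((k + i) %% T) j < entry M ((k + i') %% T) j) =
    (entry M (k + i) j < entry M (k + i') j) /\
    (entry M ((k + i') %% T) j < entry M ((k + i) %% T) j) =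
    (entry M (k + i') j < entry M (k + i) j).
  move=> lt_i lt_i'; have [lt_T|le_T] := ltnP (k + i') T.
    by rewrite !modn_small //; lia.
  have /andP[lt_e lt_w] : (entry M (k + i) j < entry M (k + i') j) &&
      (entry M ((k + i) %% T) j < entry M ((k + i') %% T) j).
    by apply: wrap_order => //; lia.
  by rewrite lt_e lt_w !ltnNge (ltnW lt_e) (ltnW lt_w).
have [lt|lt|->] := ltngtP l l'; last by rewrite !ltnn.
  by have [] := lt_wrap l l' lt lt_l'.
by have [] := lt_wrap l' l lt lt_l.
Qed.

End Stuck.

Lemma double_le_dperm_card d m : 0 < d.-1 -> 0 < m ->
  m + m <= #|{: dperm d m.+1}|.
Proof.
move=> d_gt0 m_gt0; rewrite card_tuple card_Sn.
have le_fact : m + m <= (m.+1)`!.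
  rewrite factS; have := fact_gt0 m; case: m m_gt0 => // k _.
  by rewrite factS; have := fact_gt0 k; nia.
apply: leq_trans le_fact _; by rewrite -[leqLHS]expn1 leq_pexp2l ?fact_gt0.
Qed.

Theorem theorem2p6 (d n : nat) (hd : 2 <= d) (hn : 2 <= n) :
  (exists U' : mat d, greedy_output n U') /\
  (forall U' : mat d, greedy_output n U' ->
     is_ucycle n (reduced (drop_last_columns n.-1 U'))).
Proof.
case: n hn => // m; rewrite ltnS => m_gt0.
have d1_gt0 : 0 < d.-1 by case: d hd => [|[]].
pose j0 : 'I_d.-1 := Ordinal d1_gt0.
split=> [|M [T [/(greedy_state_inv j0 m_gt0) inv stuck]] p].
  exact: greedy_output_exists.
have le_mmT : m + m <= T.
  by rewrite (steps_card inv stuck) double_le_dperm_card.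
have -> : drop_last_columns m.+1.-1 M = block 0 T M.
  by rewrite /drop_last_columns (inv_size inv) addnK /block drop0.
have sz_U : size (reduced (block 0 T M)) = T.
  by rewrite size_reduced size_block // (inv_size inv) leq_addr.
have [t lt_t eq_t] := all_patterns_used inv stuck p.
have lt_t' : t < size (reduced (block 0 T M)) by rewrite sz_U.
exists (Ordinal lt_t'); split=> [|[k lt_k] /=].
  by rewrite cyclic_window_block.
have lt_kT : k < T by rewrite -sz_U.
rewrite cyclic_window_block // -eq_t => eq_k; apply: val_inj => /=.
exact: window_index_inj inv lt_t lt_kT (esym eq_k).
Qed.
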